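(* Let $m,n$ be positive integers, let $K$ be a field and let $S=K[x_{ij} : 1\le i\le m,\ 1\le j\le n]$ with the $\mathbb{Z}^m$-grading $\deg x_{ij}=e_i$. Let $L=(\ell_{ij})$ be an $m\times n$ matrix of linear forms with $\ell_{ij}\in S_{e_i}$ (possibly zero). Let $K[\ell_{ij}]\subseteq S$ be the $K$-subalgebra generated by the entries of $L$, and let $I_2(L)$ be the ideal of $K[\ell_{ij}]$ generated by the $2$-minors of $L$. For $i\in[m]=\{1,\dots,m\}$ let $V_i=\{\lambda\in K^n : \sum_{j=1}^n\lambda_j\ell_{ij}=0\}$, and for $A\subseteq[m]$ set $$\phi(A)=n-\dim_K\sum_{i\in A}V_i .$$ Then the $\mathbb{Z}^m$-graded Hilbert series of $K[\ell_{ij}]/I_2(L)$ is $$\sum_{A\subseteq[m]}\ \sum_{\substack{a\in\mathbb{N}^m\\ \operatorname{Supp}(a)=A}}\binom{\phi(A)-1+|a|}{\phi(A)-1}\,y^a .$$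
   Context: $\mathbb{N}$ includes $0$; $e_1,\dots,e_m$ is the canonical basis of $\mathbb{Z}^m$, and $S_{e_i}$ is the space of homogeneous elements of degree $e_i$. For $a=(a_1,\dots,a_m)\in\mathbb{N}^m$: $\operatorname{Supp}(a)=\{i\in[m] : a_i>0\}$, $|a|=a_1+\dots+a_m$, $y^a=y_1^{a_1}\cdots y_m^{a_m}$. The Hilbert series of a $\mathbb{Z}^m$-graded module $M$ is $\sum_a(\dim_K M_a)\,y^a$. Binomial coefficients $\binom{k}{-1}$ with $k\ge 0$ are $0$ (this occurs when $\phi(A)=0$). *)

(* Defs.v *)
From HB Require Import structures.
From mathcomp Require Import all_boot all_order all_algebra.
From mathcomp Require Import mpoly.

Set Implicit Arguments.
Unset Strict Implicit.
Unset Printing Implicit Defensive.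

Import Order.TTheory GRing.Theory Num.Theory.
Local Open Scope ring_scope.

(* S = K[x_ij] is {mpoly K[m * n]}; its variable x_ij is
   'X_(mxvec_index i j), for the bijection mxvec_index : 'I_m * 'I_n ~ 'I_(m * n). *)

(* Degree of a monomial for the Z^m-grading deg x_ij = e_i. *)
Definition multideg (m n : nat) (u : 'X_{1..m * n}) : {ffun 'I_m -> int} :=
  [ffun i => (\sum_(j < n) u (mxvec_index i j))%N%:Z].

(* f \in S_a; as usual, 0 is in every S_a. *)
Definition multihomog (m n : nat) (K : fieldType) (a : {ffun 'I_m -> int})
    (f : {mpoly K[m * n]}) : Prop :=
  forall u, u \in msupp f -> multideg u = a.

Definition std_basis (m : nat) (i : 'I_m) : {ffun 'I_m -> int} :=
  [ffun k => (k == i)%:Z].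

Inductive subalg_gen (K : fieldType) (S : algType K) (G : S -> Prop) : S -> Prop :=
| subalg_gen_incl f : G f -> subalg_gen G f
| subalg_gen_scalar c : subalg_gen G c%:A
| subalg_gen_add f g : subalg_gen G f -> subalg_gen G g -> subalg_gen G (f + g)
| subalg_gen_mul f g : subalg_gen G f -> subalg_gen G g -> subalg_gen G (f * g).

(* The ideal of the subring R of S (not of S itself) generated by G. *)
Inductive ideal_gen (S : comNzRingType) (R G : S -> Prop) : S -> Prop :=
| ideal_gen_incl g : G g -> ideal_gen R G g
| ideal_gen_zero : ideal_gen R G 0
| ideal_gen_add f g : ideal_gen R G f -> ideal_gen R G g -> ideal_gen R G (f + g)
| ideal_gen_mul r f : R r -> ideal_gen R G f -> ideal_gen R G (r * f).

Definition matrix_subalg (m n : nat) (K : fieldType) (L : 'M[{mpoly K[m * n]}]_(m, n)) :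
    {mpoly K[m * n]} -> Prop :=
  subalg_gen (fun f => exists i j, f = L i j).

Definition minor2 (m n : nat) (K : fieldType) (L : 'M[{mpoly K[m * n]}]_(m, n))
    (f : {mpoly K[m * n]}) : Prop :=
  exists (r : 'I_2 -> 'I_m) (c : 'I_2 -> 'I_n),
    [/\ (r ord0 < r ord_max)%N, (c ord0 < c ord_max)%N & f = \det (mxsub r c L)].

Definition minor2_ideal (m n : nat) (K : fieldType) (L : 'M[{mpoly K[m * n]}]_(m, n)) :
    {mpoly K[m * n]} -> Prop :=
  ideal_gen (matrix_subalg L) (minor2 L).

(* dim_K (W / (W \cap U)) = d, for subspaces W and U of V: the classes of
   v_0, ..., v_(d-1) \in W form a basis of the image of W in V / U. *)
Definition quotient_dim (K : fieldType) (V : lmodType K) (W U : V -> Prop) (d : nat) : Prop :=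
  exists v : 'I_d -> V,
    [/\ forall k, W (v k),
        forall f, W f -> exists c : 'I_d -> K, U (f - \sum_k c k *: v k)
      & forall c : 'I_d -> K, U (\sum_k c k *: v k) -> forall k, c k = 0].

(* The series \sum_a (H a) y^a, given by its coefficients, is the Z^m-graded
   Hilbert series of R / I, for R a graded subalgebra of S and I a homogeneous
   ideal of R: the component of degree a of R / I is the image of R \cap S_a. *)
Definition is_hilbert_series (m n : nat) (K : fieldType) (R I : {mpoly K[m * n]} -> Prop)
    (H : {ffun 'I_m -> int} -> nat) : Prop :=
  forall a, quotient_dim (fun f => R f /\ multihomog a f) I (H a).

(* The space of linear relations between p_0, ..., p_(n-1), as the kernel of
   the map sending lam to the coefficients of \sum_j lam_j p_j; only monomials
   of degree less than d can occur. See mem_linrel. *)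
Definition linrel_map (N n : nat) (K : fieldType) (d : nat) (p : 'I_n -> {mpoly K[N]})
    (lam : 'rV[K]_n) : {ffun 'X_{1..N < d} -> K^o} :=
  [ffun b : 'X_{1..N < d} => (\sum_j lam 0 j *: p j)@_(val b)].

Fact linrel_map_linear (N n : nat) (K : fieldType) (d : nat) (p : 'I_n -> {mpoly K[N]}) :
  linear (@linrel_map N n K d p).
Proof.
move=> a u v; apply/ffunP=> b; rewrite !ffunE.
rewrite -[RHS]/(a * (\sum_j u 0 j *: p j)@_(val b) + (\sum_j v 0 j *: p j)@_(val b)).
rewrite -mcoeffZ -mcoeffD; congr (_ @_ _).
rewrite scaler_sumr -big_split; apply: eq_bigr => j _ /=.
by rewrite !mxE scalerA -scalerDl.
Qed.

HB.instance Definition _ (N n : nat) (K : fieldType) (d : nat) (p : 'I_n -> {mpoly K[N]}) :=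
  GRing.isLinear.Build K 'rV[K]_n {ffun 'X_{1..N < d} -> K^o} _
    (@linrel_map N n K d p) (@linrel_map_linear N n K d p).

Definition linrel (N n : nat) (K : fieldType) (p : 'I_n -> {mpoly K[N]}) :
    {vspace 'rV[K]_n} :=
  lker (linfun (@linrel_map N n K (\max_j msize (p j)) p)).

Lemma mem_linrel (N n : nat) (K : fieldType) (p : 'I_n -> {mpoly K[N]}) (lam : 'rV[K]_n) :
  (lam \in linrel p) = (\sum_j lam 0 j *: p j == 0).
Proof.
rewrite memv_ker lfunE /=; apply/eqP/eqP => [h|h]; last first.
  by apply/ffunP=> b; rewrite !ffunE h mcoeff0.
apply/mpolyP=> u; rewrite mcoeff0.
case: (ltnP (mdeg u) (\max_j msize (p j))) => [lt_u|ge_u].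
  by have /ffunP/(_ (BMultinom lt_u)) := h; rewrite !ffunE.
rewrite linear_sum big1 // => j _ /=; rewrite mcoeffZ memN_msupp_eq0 ?mulr0 //.
by apply: msize_mdeg_ge; apply: leq_trans ge_u; apply: leq_bigmax.
Qed.

Definition phi (m n : nat) (K : fieldType) (L : 'M[{mpoly K[m * n]}]_(m, n))
    (A : {set 'I_m}) : nat :=
  (n - \dim (\sum_(i in A) linrel (fun j => L i j))%VS)%N.

Definition Supp (m : nat) (a : {ffun 'I_m -> int}) : {set 'I_m} := [set i | 0 < a i].

(* |a|; only used for a \in N^m. *)
Definition abs_deg (m : nat) (a : {ffun 'I_m -> int}) : nat := (\sum_i `|a i|)%N.

(* binomial (p - 1 + k) (p - 1), which is 0 for p = 0. *)
Definition bin_pred (p k : nat) : nat := if p is q.+1 then 'C(q + k, q) else 0%N.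

(* Main.v *)
From HB Require Import structures.
Require Import Defs.
From mathcomp Require Import all_boot all_order all_algebra.
From mathcomp Require Import mpoly.

Import Order.TTheory GRing.Theory Num.Theory.
Local Open Scope ring_scope.
Set Implicit Arguments.
Unset Strict Implicit.

(** Fix a degree b in N^m, put A = Supp b, W = sum of the V_i over i in A, and
    p = dim (K^n / W) = phi(A). For a row i and mu in K^n write l_i(mu) for the
    linear form sum_j mu_j l_ij, so that V_i is the kernel of l_i. The degree b
    part of K[l_ij] is spanned by the products of |b| factors l_i(mu) in which
    each row i occurs b_i times ([subalg_multihomog_expansion]); the claim is
    that, modulo the minors, this part is the symmetric power of degree |b| of
    K^n / W, that is, the space of forms of degree |b| in p variables.

    - Upper bound. The minors make l_i(mu) l_i'(nu) congruent to
      l_i(nu) l_i'(mu), hence a product depends only on the multiset of its rows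
      and the multiset of its vectors ([form_prod_congr]). So a factor
      l_i(nu) with nu in V_i' can exchange its vector with a factor of row i', as
      long as row i' occurs in the product, and then vanishes. All rows of A do
      occur, so the vectors only matter modulo W ([form_prod_sum_linrel]).
      Choosing a basis of a complement of W, one is left with one product for
      each multiset of |b| of the p basis vectors ([std_span_form_prod]).
    - Lower bound. Since ker l_i = V_i lies in W for i in A, the projection
      K^n -> K^n / W factors through l_i. Hence there is a ring morphism
      [theta] from S to K[z_1, ..., z_p] which maps l_i(mu) to the class of mu
      if i is in A, and to 0 otherwise. It kills all the minors, as the
      image of l_i(mu) no longer depends on the row i in A, and maps the
      products retained above to distinct monomials ([std_prod_indep]).

    Multisets of size d in a p-element set are sorted d-tuples, counted by
    [card_sorted_tuples]. *)

(** * Linear algebra *)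

Lemma det_mx2 (R : comNzRingType) (M : 'M[R]_2) :
  \det M = M ord0 ord0 * M ord_max ord_max - M ord0 ord_max * M ord_max ord0.
Proof.
have lift00 : lift ord0 ord0 = ord_max :> 'I_2 by apply: val_inj.
have lift10 : lift ord_max ord0 = ord0 :> 'I_2 by apply: val_inj.
rewrite (expand_det_row _ ord0) big_ord_recl big_ord1 /cofactor !det_mx11 lift00.
by rewrite !mxE lift00 lift10 /= expr0 mul1r expr1 mulN1r mulrN.
Qed.

(** [P] is the projection along [W] onto coordinates of the quotient, and the
    rows of [Q] lift the coordinate vectors, so they form a basis of a
    complement of [W]. *)
Lemma subspace_as_kernel (K : fieldType) (n : nat) (W : {vspace 'rV[K]_n}) :
  exists (p : nat) (P : 'M[K]_(n, p)) (Q : 'M[K]_(p, n)),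
    [/\ p = (n - \dim W)%N, Q *m P = 1%:M
      & forall mu, (mu \in W) = (mu *m P == 0)].
Proof.
pose M := \matrix_(i < \dim W) (vbasis W)`_i.
have WE mu : (mu \in W) = (mu <= M)%MS.
  apply/idP/idP=> [/coord_vbasis ->|/submxP[D ->]].
    apply: summx_sub => i _; apply: scalemx_sub.
    by rewrite -(rowK (fun i : 'I_(\dim W) => (vbasis W)`_i)) row_sub.
  rewrite mulmx_sum_row; apply: memv_suml => i _; apply: memvZ.
  by rewrite rowK vbasis_mem // mem_nth // size_tuple.
have rkM : \rank M = \dim W.
  apply/eqP; change (row_free M); rewrite -kermx_eq0.
  apply/eqP/row_matrixP => i; rewrite row0; apply/rowP => k; rewrite [RHS]mxE.
  have : row i (kermx M) *m M = 0 by rewrite -row_mul mulmx_ker row0.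
  rewrite mulmx_sum_row => eq0.
  have /freeP indep := basis_free (vbasisP W).
  apply: (indep (row i (kermx M) 0)).
  by rewrite -[RHS]eq0; apply: eq_bigr => j _; rewrite rowK.
have [Q QP] := row_fullP (col_base_full (cokermx M)).
exists (\rank (cokermx M)), (col_base (cokermx M)), Q; split => //.
  by rewrite mxrank_coker rkM.
move=> mu; rewrite WE submxE -{1}[cokermx M]mulmx_base mulmxA.
have [B RB] := row_freeP (row_base_free (cokermx M)).
apply/eqP/eqP => [eq0|->]; last by rewrite mul0mx.
by rewrite -[LHS]mulmx1 -RB mulmxA eq0 mul0mx.
Qed.

(** * The multigrading *)

Section Multihomogeneous.

Variables (m n : nat) (K : fieldType).
Implicit Types (f g : {mpoly K[m * n]}) (a : {ffun 'I_m -> int}).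

Lemma multidegD (u v : 'X_{1..m * n}) :
  multideg (u + v)%MM = multideg u + multideg v.
Proof.
apply/ffunP=> i; rewrite !ffunE -PoszD -big_split /=; congr (Posz _).
by apply: eq_bigr => j _; rewrite mnmDE.
Qed.

Lemma multihomog_coef0 a f u : multihomog a f -> multideg u <> a -> f@_u = 0.
Proof.
by move=> homf neq; apply: memN_msupp_eq0; apply/negP => /homf.
Qed.

Lemma multihomog1 : multihomog 0 (1 : {mpoly K[m * n]}).
Proof.
move=> u; rewrite msupp1 inE => /eqP ->; apply/ffunP => i.
by rewrite !ffunE big1 // => j _; rewrite mnm0E.
Qed.

Lemma multihomogM a b f g :
  multihomog a f -> multihomog b g -> multihomog (a + b) (f * g).
Proof.
move=> homf homg u /msuppM_le/allpairsP[[v w] [/= /homf <- /homg <- ->]].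
exact: multidegD.
Qed.

Lemma multihomogZ a c f : multihomog a f -> multihomog a (c *: f).
Proof. by move=> homf u /msuppZ_le; apply: homf. Qed.

Lemma multihomog_sum a (I : Type) (r : seq I) (F : I -> {mpoly K[m * n]}) :
  (forall i, multihomog a (F i)) -> multihomog a (\sum_(i <- r) F i).
Proof.
move=> homF; elim/big_ind: _ => [u|f g homf homg u|//]; first by rewrite msupp0.
by move/msuppD_le; rewrite mem_cat => /orP[/homf|/homg].
Qed.

Lemma linear_form_expansion (i : 'I_m) f : multihomog (std_basis i) f ->
  f = \sum_(k < n) f@_U_(mxvec_index i k) *: 'X_(mxvec_index i k).
Proof.
move=> homf; apply/mpolyP => u; rewrite linear_sum /=.
have [fu0|/eqP] := eqVneq f@_u 0.
  rewrite fu0 big1 // => k _; rewrite mcoeffZ mcoeffX.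
  by case: eqP => [->|]; rewrite ?fu0 ?mul0r ?mulr0.
move/eqP; rewrite -mcoeff_msupp => /homf /ffunP deg_u.
(* The total degree is the sum of the row degrees, here 1. *)
have /eqP/mdeg1P[k] : mdeg u = 1%N.
  rewrite mdegE (reindex _ (curry_mxvec_bij m n)) /=.
  rewrite (eq_bigr (fun p => u (mxvec_index p.1 p.2))) => [|[] //].
  rewrite -(pair_bigA _ (fun i k => u (mxvec_index i k))) /=.
  have row_sum i' : (\sum_(k < n) u (mxvec_index i' k))%N = (i' == i).
    by have := deg_u i'; rewrite !ffunE => -[].
  rewrite (eq_bigr _ (fun i' _ => row_sum i')) (bigD1 i) //= eqxx big1 // => i'.
  by move/negbTE->.
case/mxvec_indexP: k => i' k /eqP def_u.
have ei : i' = i.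
  have := deg_u i'; rewrite !ffunE (bigD1 k) //= def_u mnm1E eqxx add1n.
  by case: eqP => // _ [].
rewrite def_u ei (bigD1 k) //= big1 => [|j ne_j]; last first.
  rewrite mcoeffZ mcoeffX eq_mnm1 (inj_eq (@cast_ord_inj _ _ _)).
  by rewrite (inj_eq enum_rank_inj) xpair_eqE eqxx (negbTE ne_j) mulr0.
by rewrite addr0 mcoeffZ mcoeffX eqxx mulr1.
Qed.

End Multihomogeneous.

(** * Products of linear forms modulo the minors *)

Section MinorIdeal.

Variables (m n : nat) (K : fieldType) (L : 'M[{mpoly K[m * n]}]_(m, n)).
Local Notation R := (matrix_subalg L).
Local Notation I := (minor2_ideal L).
Local Notation factor := ('I_m * 'rV[K]_n)%type.

Definition row_form (i : 'I_m) (mu : 'rV[K]_n) : {mpoly K[m * n]} :=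
  \sum_j mu 0 j *: L i j.

(** The factors are recorded as pairs (row, vector), so that the multisets of
    rows and of vectors can be read off separately. *)
Definition form_prod (ps : seq factor) : {mpoly K[m * n]} :=
  \prod_(q <- ps) row_form q.1 q.2.

Lemma row_form_is_linear i : linear (row_form i).
Proof.
move=> c mu nu; rewrite /row_form scaler_sumr -big_split /=.
by apply: eq_bigr => j _; rewrite !mxE scalerDl scalerA.
Qed.

HB.instance Definition _ i :=
  GRing.isLinear.Build K 'rV[K]_n {mpoly K[m * n]} _ (row_form i)
    (@row_form_is_linear i).

Lemma row_form_delta i j : row_form i (delta_mx 0 j) = L i j.
Proof.
rewrite /row_form (bigD1 j) //= !mxE !eqxx scale1r big1 ?addr0 // => k ne_k.
by rewrite !mxE (negbTE ne_k) andbF scale0r.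
Qed.

Lemma row_form_eq0 i mu : (row_form i mu == 0) = (mu \in linrel (fun j => L i j)).
Proof. by rewrite mem_linrel. Qed.

Lemma form_prod_cons i mu ps :
  form_prod ((i, mu) :: ps) = row_form i mu * form_prod ps.
Proof. by rewrite /form_prod big_cons. Qed.

Lemma perm_form_prod ps qs : perm_eq ps qs -> form_prod ps = form_prod qs.
Proof. exact: perm_big. Qed.

Lemma subalgZ c f : R f -> R (c *: f).
Proof.
rewrite -mulr_algl => Rf; apply: subalg_gen_mul Rf; exact: subalg_gen_scalar.
Qed.

Lemma subalg0 : R 0.
Proof. by rewrite -(scale0r 1); apply: subalg_gen_scalar. Qed.

Lemma subalg1 : R 1.
Proof. by rewrite -(scale1r 1); apply: subalg_gen_scalar. Qed.

Lemma subalg_row_form i mu : R (row_form i mu).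
Proof.
rewrite /row_form; elim/big_ind: _ => [|f g|j _]; first exact: subalg0.
  exact: subalg_gen_add.
by apply: subalgZ; apply: subalg_gen_incl; exists i, j.
Qed.

Lemma subalg_form_prod ps : R (form_prod ps).
Proof.
rewrite /form_prod; elim/big_ind: _ => [|f g|q _]; first exact: subalg1.
  exact: subalg_gen_mul.
exact: subalg_row_form.
Qed.

Lemma minor_idealZ c f : I f -> I (c *: f).
Proof.
by move=> If; rewrite -mulr_algl; apply: ideal_gen_mul If; apply: subalg_gen_scalar.
Qed.

Lemma minor_idealN f : I f -> I (- f).
Proof. by rewrite -scaleN1r; apply: minor_idealZ. Qed.

Lemma minor_ideal_sum (T : Type) (r : seq T) (P : pred T) F :
  (forall t, P t -> I (F t)) -> I (\sum_(t <- r | P t) F t).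
Proof.
move=> IF; elim/big_ind: _ => [|f g|t /IF//]; first exact: ideal_gen_zero.
exact: ideal_gen_add.
Qed.

(** The minors in the definition of the ideal have increasing rows and columns;
    the other choices differ by a sign or vanish. *)
Lemma entry_swap i i' j j' : I (L i j * L i' j' - L i j' * L i' j).
Proof.
wlog lt_i : i i' j j' / (i < i')%N => [gen|].
  case: (ltngtP i i') => [|lt_i|/val_inj <-]; first exact: gen.
    by rewrite mulrC (mulrC (L i j')); apply: gen.
  by rewrite (mulrC (L i j')) subrr; apply: ideal_gen_zero.
wlog lt_j : j j' / (j < j')%N => [gen|].
  case: (ltngtP j j') => [|lt_j|/val_inj <-]; first exact: gen.
    by rewrite -opprB; apply: minor_idealN; apply: gen.
  by rewrite subrr; apply: ideal_gen_zero.
apply: ideal_gen_incl.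
exists (fun t : 'I_2 => if t == ord0 then i else i').
exists (fun t : 'I_2 => if t == ord0 then j else j'); split; [exact: lt_i|exact: lt_j|].
by rewrite det_mx2 !mxE.
Qed.

Lemma row_form_swap i i' mu nu :
  I (row_form i mu * row_form i' nu - row_form i nu * row_form i' mu).
Proof.
rewrite /row_form !big_distrlr /= [X in _ - X]exchange_big /= -sumrB.
apply: minor_ideal_sum => j _; rewrite -sumrB; apply: minor_ideal_sum => k _.
rewrite -!scalerAl -!scalerAr !scalerA [nu _ _ * _]mulrC -scalerBr.
by apply: minor_idealZ; apply: entry_swap.
Qed.

Lemma form_prod_swap i i' mu nu ps :
  I (form_prod [:: (i, mu), (i', nu) & ps] -
     form_prod [:: (i, nu), (i', mu) & ps]).
Proof.
rewrite !form_prod_cons !mulrA -mulrBl mulrC.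
by apply: ideal_gen_mul; [apply: subalg_form_prod|apply: row_form_swap].
Qed.

(** Induction on the number of factors. To match the first factor (i, mu) of
    [ps], pick in [qs] a factor (i, nu) and, if nu is not mu, a factor (i', mu);
    one exchange of vectors turns these into (i, mu) and (i', nu). *)
Lemma form_prod_congr ps qs :
    perm_eq (unzip1 ps) (unzip1 qs) -> perm_eq (unzip2 ps) (unzip2 qs) ->
  I (form_prod ps - form_prod qs).
Proof.
elim: ps qs => [|[i mu] ps IH] qs /= perm1 perm2.
  have /nilP-> : nilp qs by rewrite /nilp -(size_map fst) -(perm_size perm1).
  by rewrite subrr; apply: ideal_gen_zero.
have /mapP[[i' nu] qs_inu /= def_i] : i \in unzip1 qs.
  by rewrite -(perm_mem perm1) mem_head.
rewrite -{i'}def_i in qs_inu.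
have perm_qs := perm_to_rem qs_inu; set rs := rem _ _ in perm_qs.
rewrite (perm_form_prod perm_qs).
move: perm1 perm2; rewrite (permPr (perm_map _ perm_qs)) => /= perm1.
rewrite (permPr (perm_map _ perm_qs)) => /= perm2.
rewrite perm_cons in perm1.
have step rs' : perm_eq (unzip1 ps) (unzip1 rs') ->
    perm_eq (unzip2 ps) (unzip2 rs') ->
    I (form_prod ((i, mu) :: ps) - form_prod ((i, mu) :: rs')).
  move=> p1 p2; rewrite !form_prod_cons -mulrBr; apply: ideal_gen_mul.
    exact: subalg_row_form.
  exact: IH.
have [e|ne_mu] := eqVneq mu nu.
  by rewrite -e in perm2 *; rewrite perm_cons in perm2; apply: step.
have : mu \in nu :: unzip2 rs by rewrite -(perm_mem perm2) mem_head.
rewrite inE (negbTE ne_mu) /= => /mapP[[i' mu'] rs_imu /= def_mu].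
rewrite -{mu'}def_mu in rs_imu.
have perm_rs := perm_to_rem rs_imu; set us := rem _ _ in perm_rs.
have -> : form_prod ((i, nu) :: rs) = form_prod [:: (i, nu), (i', mu) & us].
  by apply: perm_form_prod; rewrite perm_cons.
rewrite -(subrK (form_prod [:: (i, mu), (i', nu) & us]) (form_prod ((i, mu) :: ps))).
rewrite -addrA; apply: ideal_gen_add; last exact: form_prod_swap.
apply: step; first by rewrite (permPl perm1) (permPl (perm_map _ perm_rs)).
rewrite -(perm_cons mu) (permPl perm2) perm_sym.
rewrite (perm_catCA [:: mu] [:: nu] (unzip2 us)) /= perm_cons perm_sym.
exact: perm_map perm_rs.
Qed.

(** Exchanging vectors with a factor of row [i0] creates the factor
    l_i0(nu) = 0; if [i] is [i0], this factor is already there. *)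
Lemma form_prod_linrel i i0 nu ps :
    nu \in linrel (fun j => L i0 j) -> i0 \in i :: unzip1 ps ->
  I (form_prod ((i, nu) :: ps)).
Proof.
rewrite -row_form_eq0 => /eqP form0; rewrite inE.
case: (i0 =P i) => [<- _|_ /= /mapP[[i1 mu] ps_imu /= def_i0]].
  by rewrite form_prod_cons form0 mul0r; apply: ideal_gen_zero.
rewrite -{i1}def_i0 in ps_imu.
have -> : form_prod ((i, nu) :: ps) =
    form_prod [:: (i, nu), (i0, mu) & rem (i0, mu) ps].
  by apply: perm_form_prod; rewrite perm_cons perm_to_rem.
have := form_prod_swap i i0 nu mu (rem (i0, mu) ps).
by rewrite !form_prod_cons form0 mul0r mulr0 subr0.
Qed.

Lemma form_prod_sum_linrel (A : {set 'I_m}) i nu ps :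
    {subset A <= i :: unzip1 ps} ->
    nu \in (\sum_(i0 in A) linrel (fun j => L i0 j))%VS ->
  I (form_prod ((i, nu) :: ps)).
Proof.
move=> sub_A /memv_sumP[mu Vmu ->]; rewrite form_prod_cons linear_sum mulr_suml.
apply: minor_ideal_sum => i0 A_i0; rewrite -form_prod_cons.
by apply: form_prod_linrel (Vmu _ A_i0) _; apply: sub_A.
Qed.

Lemma subalg_expansion f : R f ->
  exists ts : seq (K * seq factor), f = \sum_(t <- ts) t.1 *: form_prod t.2.
Proof.
elim=> {f} [f [i [j ->]]|c|f g _ [ts ->] _ [us ->]|f g _ [ts ->] _ [us ->]].
- exists [:: (1, [:: (i, delta_mx 0 j)])].
  by rewrite big_seq1 /= scale1r /form_prod big_seq1 row_form_delta.
- by exists [:: (c, [::])]; rewrite big_seq1 /= /form_prod big_nil.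
- by exists (ts ++ us); rewrite big_cat.
exists [seq (t.1 * u.1, t.2 ++ u.2) | t <- ts, u <- us].
rewrite big_allpairs_dep big_distrlr; apply: eq_bigr => t _; apply: eq_bigr => u _ /=.
by rewrite /form_prod big_cat /= -scalerAl -scalerAr scalerA.
Qed.

(** The multidegree of a product of row forms with these factors. *)
Definition row_deg (ps : seq factor) : {ffun 'I_m -> int} :=
  [ffun i => (count_mem i (unzip1 ps))%:Z].

Hypothesis L_deg : forall i j, multihomog (std_basis i) (L i j).

Lemma multihomog_row_form i mu : multihomog (std_basis i) (row_form i mu).
Proof. by apply: multihomog_sum => j; apply: multihomogZ. Qed.

Lemma multihomog_form_prod ps : multihomog (row_deg ps) (form_prod ps).
Proof.
elim: ps => [|[i mu] ps IH].
  rewrite /form_prod big_nil.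
  by have -> : row_deg [::] = 0 by [apply/ffunP => i; rewrite !ffunE]; apply: multihomog1.
rewrite form_prod_cons.
have -> : row_deg ((i, mu) :: ps) = std_basis i + row_deg ps.
  by apply/ffunP => k; rewrite !ffunE /= eq_sym.
by apply: multihomogM IH; apply: multihomog_row_form.
Qed.

(** Each product is multihomogeneous, so the terms of other degrees in an
    expansion of [f] cancel and can be dropped. *)
Lemma subalg_multihomog_expansion b f : R f -> multihomog b f ->
  exists2 ts : seq (K * seq factor), all (fun t => row_deg t.2 == b) ts
    & f = \sum_(t <- ts) t.1 *: form_prod t.2.
Proof.
case/subalg_expansion => ts def_f homf.
exists [seq t <- ts | row_deg t.2 == b]; first exact: filter_all.
rewrite big_filter; apply/eqP; rewrite -subr_eq0; apply/eqP/mpolyP => u.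
rewrite mcoeff0; have [deg_u|/eqP ne_u] := eqVneq (multideg u) b.
  rewrite def_f (bigID (fun t => row_deg t.2 == b)) /= addrC addrK linear_sum.
  rewrite big1 // => t /eqP ne_b /=; rewrite mcoeffZ.
  rewrite (multihomog_coef0 (@multihomog_form_prod _)) ?mulr0 // deg_u.
  by move=> e; apply: ne_b.
rewrite mcoeffB (multihomog_coef0 homf ne_u) linear_sum sub0r big1 ?oppr0 //=.
move=> t /eqP def_b; rewrite mcoeffZ (multihomog_coef0 (@multihomog_form_prod _)).
  by rewrite mulr0.
by rewrite def_b.
Qed.

(** * Standard products span *)

Section Reduction.

Variables (A : {set 'I_m}) (p : nat) (P : 'M[K]_(n, p)) (Q : 'M[K]_(p, n)).
Hypothesis QP : Q *m P = 1%:M.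
Hypothesis kerP : forall mu,
  (mu \in (\sum_(i in A) linrel (fun j => L i j))%VS) = (mu *m P == 0).

Variable s : seq 'I_m.
Hypothesis mem_s : s =i A.

(** The rows are fixed by [s]; only the basis vectors of the complement of W,
    that is, the rows of [Q], vary. *)
Definition std_prod (ks : seq 'I_p) : {mpoly K[m * n]} :=
  form_prod (zip s [seq row k Q | k <- ks]).

Definition sorted_tuples : {set (size s).-tuple 'I_p} :=
  [set ks : (size s).-tuple 'I_p | sorted leq (map val ks)].

Definition std_span (f : {mpoly K[m * n]}) :=
  exists c : {ffun (size s).-tuple 'I_p -> K},
    I (f - \sum_(ks in sorted_tuples) c ks *: std_prod ks).

Lemma std_span_ideal f : I f -> std_span f.
Proof.
move=> If; exists 0; rewrite big1 ?subr0 // => ks _.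
by rewrite ffunE scale0r.
Qed.

Lemma std_spanD f g : std_span f -> std_span g -> std_span (f + g).
Proof.
case=> c If [d Ig]; exists [ffun ks => c ks + d ks].
under eq_bigr do rewrite ffunE scalerDl.
by rewrite big_split opprD addrACA; apply: ideal_gen_add.
Qed.

Lemma std_spanZ c f : std_span f -> std_span (c *: f).
Proof.
case=> d If; exists [ffun ks => c * d ks].
under eq_bigr do rewrite ffunE -scalerA.
by rewrite -scaler_sumr -scalerBr; apply: minor_idealZ.
Qed.

Lemma std_span_sum (T : eqType) (r : seq T) F :
  (forall t, t \in r -> std_span (F t)) -> std_span (\sum_(t <- r) F t).
Proof.
rewrite big_seq => spanF; elim/big_ind: _ => [|f g|t /spanF//].
  by apply: std_span_ideal; apply: ideal_gen_zero.
exact: std_spanD.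
Qed.

Lemma std_span_std_prod ks : ks \in sorted_tuples -> std_span (std_prod ks).
Proof.
move=> sort_ks; exists [ffun ks' => (ks' == ks)%:R].
rewrite (bigD1 ks) //= ffunE eqxx scale1r big1 ?addr0 ?subrr.
  exact: ideal_gen_zero.
by move=> ks' /andP[_ /negbTE ne_ks]; rewrite ffunE ne_ks scale0r.
Qed.

(** Modulo the ideal the rows can be rearranged into [s], and the indices of the
    basis vectors can be sorted. *)
Lemma std_span_basis_prod (rows : seq 'I_m) (ks : seq 'I_p) :
    size rows = size ks -> perm_eq rows s ->
  std_span (form_prod (zip rows [seq row k Q | k <- ks])).
Proof.
move=> size_eq perm_s; pose leI := (fun x y : 'I_p => leq x y).
have size_sort : size (sort leI ks) == size s.
  by rewrite size_sort -size_eq (perm_size perm_s).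
pose t := Tuple size_sort.
rewrite -(subrK (std_prod t) (form_prod _)); apply: std_spanD; last first.
  apply: std_span_std_prod; rewrite inE sorted_map.
  by apply: sort_sorted => x y; apply: leq_total.
apply/std_span_ideal/form_prod_congr.
  by rewrite !unzip1_zip ?size_map ?size_eq // (eqP size_sort).
rewrite !unzip2_zip ?size_map ?size_eq ?(eqP size_sort) //.
by apply: perm_map; rewrite perm_sym perm_sort.
Qed.

(** Write each vector as an element of W plus a combination of rows of [Q],
    one factor at a time. The first part contributes an element of the ideal,
    because the rows of the whole product cover [A]. *)
Lemma std_span_form_prod ps : perm_eq (unzip1 ps) s -> std_span (form_prod ps).
Proof.
(* us: factors still to be treated; rows, ks: those in reduced form *)
suff reduce us rows ks : size rows = size ks -> perm_eq (unzip1 us ++ rows) s ->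
    std_span (form_prod (us ++ zip rows [seq row k Q | k <- ks])).
  by move=> perm_s; have := reduce ps [::] [::] erefl; rewrite !cats0; apply.
elim: us rows ks => [|[i mu] us IH] rows ks size_eq perm_s.
  exact: std_span_basis_prod.
rewrite cat_cons; set zs := us ++ _.
have unzip_zs : unzip1 zs = unzip1 us ++ rows.
  by rewrite /unzip1 map_cat -/(unzip1 (zip _ _)) unzip1_zip ?size_map ?size_eq.
have -> : mu = (mu - mu *m P *m Q) + \sum_k (mu *m P) 0 k *: row k Q.
  by rewrite -mulmx_sum_row subrK.
rewrite form_prod_cons linearD mulrDl; apply: std_spanD.
  rewrite -form_prod_cons; apply: std_span_ideal.
  apply: (@form_prod_sum_linrel A); last first.
    by rewrite kerP mulmxBl -(mulmxA _ Q) QP mulmx1 subrr.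
  by move=> j; rewrite -mem_s unzip_zs -(perm_mem perm_s).
rewrite linear_sum mulr_suml; apply: std_span_sum => k _.
rewrite linearZ -scalerAl; apply: std_spanZ; rewrite -form_prod_cons.
have -> : form_prod ((i, row k Q) :: zs) =
    form_prod (us ++ zip (i :: rows) [seq row k Q | k <- k :: ks]).
  by apply: perm_form_prod; rewrite perm_sym /zs (perm_catCA us [:: (i, row k Q)]).
apply: IH; first by rewrite /= size_eq.
by rewrite (perm_catCA (unzip1 us) [:: i] rows).
Qed.

(** * Standard products are independent *)

(** Row [j] holds the coordinates of l_ij in the variables of row [i]; thus l_i
    is right multiplication by this matrix. *)
Definition coef_mx i : 'M[K]_n := \matrix_(j, k) (L i j)@_U_(mxvec_index i k).

Definition var_form (v : 'rV[K]_p) : {mpoly K[p]} := \sum_c v 0 c *: 'X_c.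

(** Images of the variables x_ik. The pseudo-inverse of [coef_mx i] is a section
    of l_i on its image: any section will do, as two of them differ by
    elements of V_i, which [P] kills for [i] in [A]. *)
Definition theta_mx : 'M[{mpoly K[p]}]_(m, n) :=
  \matrix_(i, k) if i \in A then var_form (row k (pinvmx (coef_mx i) *m P)) else 0.

Definition theta : {mpoly K[m * n]} -> {mpoly K[p]} :=
  mmap (@mpolyC p K) (fun k => mxvec theta_mx 0 k).

HB.instance Definition _ := GRing.RMorphism.on theta.

Lemma var_form_is_linear : linear var_form.
Proof.
move=> c mu nu; rewrite /var_form scaler_sumr -big_split /=.
by apply: eq_bigr => j _; rewrite !mxE scalerDl scalerA.
Qed.

HB.instance Definition _ :=
  GRing.isLinear.Build K 'rV[K]_p {mpoly K[p]} _ var_form var_form_is_linear.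

Lemma thetaZ c f : theta (c *: f) = c *: theta f.
Proof. by rewrite /theta mmapZ mul_mpolyC. Qed.

Lemma row_form_coef i mu :
  row_form i mu = \sum_k (mu *m coef_mx i) 0 k *: 'X_(mxvec_index i k).
Proof.
rewrite /row_form.
under eq_bigr => j _ do
  rewrite (linear_form_expansion (@L_deg i j)) scaler_sumr.
rewrite exchange_big; apply: eq_bigr => k _ /=; rewrite mxE scaler_suml.
by apply: eq_bigr => j _; rewrite scalerA mxE.
Qed.

(** The projection modulo W factors through l_i, since ker l_i is contained
    in W = ker P. *)
Lemma coef_mxK i : i \in A -> coef_mx i *m (pinvmx (coef_mx i) *m P) = P.
Proof.
move=> A_i; apply/row_matrixP => j; apply/eqP; rewrite -subr_eq0 !rowE.
rewrite -mulmxBr mulmxA -{2}[P]mul1mx -mulmxBl mulmxA -kerP.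
apply: (subvP (sumv_sup i A_i (subvv _))); rewrite -row_form_eq0 row_form_coef.
rewrite big1 // => k _; rewrite -mulmxA mulmxBl mul1mx mulmxKpV ?submx_refl //.
by rewrite subrr mulmx0 mxE scale0r.
Qed.

Lemma theta_row_form i mu :
  theta (row_form i mu) = if i \in A then var_form (mu *m P) else 0.
Proof.
rewrite row_form_coef raddf_sum /=.
under eq_bigr => k _ do rewrite thetaZ {1}/theta mmapX mmap1U mxvecE [theta_mx _ _]mxE.
case: ifP => [A_i|_]; last by rewrite big1 // => k _; rewrite scaler0.
rewrite -[in RHS](coef_mxK A_i) [in RHS]mulmxA [in RHS]mulmx_sum_row linear_sum.
by apply: eq_bigr => k _; rewrite linearZ.
Qed.

(** If both rows of a minor are in [A], it is sent to v w - w v, where v and w are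
    the classes of its two columns; otherwise one of its rows is sent to 0. *)
Lemma theta_ideal f : I f -> theta f = 0.
Proof.
elim=> {f} [_ [r [c [_ _ ->]]]||f g _ tf _ tg|f g _ _ tg].
- rewrite det_mx2 !mxE.
  rewrite -!row_form_delta rmorphB !rmorphM /= !theta_row_form.
  do 2![case: ifP => _]; rewrite ?mul0r ?mulr0 ?subrr //.
  by rewrite mulrC subrr.
- exact: rmorph0.
- by rewrite rmorphD /= tf tg addr0.
- by rewrite rmorphM /= tg mulr0.
Qed.

Definition std_mnm (ks : seq 'I_p) : 'X_{1..p} := (\sum_(k <- ks) U_(k))%MM.

Lemma theta_std_prod ks : size ks = size s -> theta (std_prod ks) = 'X_[std_mnm ks].
Proof.
move=> size_ks; rewrite /std_prod /form_prod rmorph_prod /= /std_mnm.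
have sub_A : {subset s <= A} by move=> i; rewrite mem_s.
elim: s ks sub_A size_ks => [|i s' IH] [|k ks] //= sub_A size_ks.
  by rewrite !big_nil mpolyX0.
rewrite !big_cons mpolyXD theta_row_form sub_A ?mem_head // IH; last first.
- by case: size_ks.
- by move=> j s_j; apply: sub_A; rewrite inE s_j orbT.
congr (_ * _); rewrite -row_mul QP /var_form (bigD1 k) //= !mxE eqxx scale1r.
rewrite big1 ?addr0 // => c ne_c; rewrite !mxE eq_sym (negbTE ne_c).
by rewrite scale0r.
Qed.

(** The exponents of the monomial are the multiplicities in the tuple, and a
    sorted tuple is determined by them. *)
Lemma std_mnm_inj : {in sorted_tuples &, injective (fun ks => std_mnm (val ks))}.
Proof.
move=> ks ks' /[!inE] sort_ks sort_ks' /mnmP eq_mnm; apply: val_inj.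
have countE us k : std_mnm us k = count_mem k us.
  rewrite /std_mnm mnm_sumE -sum1_count [RHS]big_mkcond /=.
  by apply: eq_bigr => c _; rewrite mnm1E; case: eqP.
apply: (inj_map val_inj); apply: (sorted_eq leq_trans anti_leq) => //.
apply: perm_map; apply/allP => k _ /=.
by rewrite -!countE eq_mnm.
Qed.

Lemma std_prod_indep (c : (size s).-tuple 'I_p -> K) :
  I (\sum_(ks in sorted_tuples) c ks *: std_prod ks) ->
  {in sorted_tuples, forall ks, c ks = 0}.
Proof.
move=> /theta_ideal; rewrite raddf_sum /= => /mpolyP eq0 ks sort_ks.
have := eq0 (std_mnm ks); rewrite mcoeff0 linear_sum (bigD1 ks) //= big1.
  rewrite addr0 thetaZ theta_std_prod ?size_tuple // mcoeffZ mcoeffX eqxx.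
  by rewrite mulr1.
move=> ks' /andP[sort_ks' ne_ks].
rewrite thetaZ theta_std_prod ?size_tuple // mcoeffZ mcoeffX.
by rewrite (inj_in_eq std_mnm_inj) // (negbTE ne_ks) mulr0.
Qed.

(** The standard products are indexed by [enum_val], as a basis in the sense of
    [quotient_dim] has to be indexed by an ordinal. *)
Lemma quotient_dim_std (b : {ffun 'I_m -> int}) : (forall i, b i = (count_mem i s)%:Z) ->
  quotient_dim (fun f => R f /\ multihomog b f) I #|sorted_tuples|.
Proof.
move=> count_s; exists (fun k : 'I_#|sorted_tuples| => std_prod (enum_val k)); split.
- move=> k; split; first exact: subalg_form_prod.
  set ks := enum_val k; have size_ks : size ks = size s by rewrite size_tuple.
  have -> : b = row_deg (zip s [seq row k Q | k <- ks]).
    apply/ffunP => i; rewrite count_s ffunE unzip1_zip // size_map size_ks.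
    exact: leqnn.
  exact: multihomog_form_prod.
- move=> f [Rf homf].
  have [ts /allP deg_ts ->] := subalg_multihomog_expansion Rf homf.
  suff [c Ic] : std_span (\sum_(t <- ts) t.1 *: form_prod t.2).
    exists (fun k => c (enum_val k)).
    by rewrite -(big_enum_val (fun ks : (size s).-tuple 'I_p => c ks *: std_prod ks)).
  apply: std_span_sum => t /deg_ts /eqP/ffunP deg_t; apply: std_spanZ.
  apply: std_span_form_prod; apply/allP => i _ /=; apply/eqP.
  by have := deg_t i; rewrite count_s ffunE => -[].
move=> c Ic k.
have [ks_t|ks_f] := boolP (enum_val k \in sorted_tuples); last first.
  by rewrite enum_valP in ks_f.
pose d ks := c (enum_rank_in ks_t ks).
rewrite -[k](enum_valK_in ks_t); apply: (@std_prod_indep d) => //.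
rewrite big_enum_val; under eq_bigr do rewrite /d enum_valK_in.
exact: Ic.
Qed.

End Reduction.

End MinorIdeal.

(** * The Hilbert series *)

(** For p = d = 0 the empty tuple is counted on the left, whereas
    [bin_pred 0 0] is 0. *)
Lemma card_sorted_tuples_bin_pred p d : (0 < p + d)%N ->
  #|[set ks : d.-tuple 'I_p | sorted leq (map val ks)]| = bin_pred p d.
Proof.
case: p => [|p] /=; last first.
  by rewrite card_sorted_tuples -(bin_sub (leq_addr p d)) addKn (addnC d).
case: d => // d _; apply: eq_card0 => ks.
by case: (tnth ks ord0).
Qed.

Definition row_seq (m : nat) (b : {ffun 'I_m -> int}) : seq 'I_m :=
  flatten [seq nseq `|b i|%N i | i <- enum 'I_m].

Lemma count_row_seq m (b : {ffun 'I_m -> int}) i :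
  count_mem i (row_seq b) = `|b i|%N.
Proof.
rewrite count_flatten -map_comp sumnE big_map big_enum (bigD1 i) //= big1 ?addn0.
  by rewrite count_nseq /= eqxx mul1n.
by move=> j /negbTE ne_j; rewrite count_nseq /= ne_j.
Qed.

Lemma size_row_seq m (b : {ffun 'I_m -> int}) : size (row_seq b) = abs_deg b.
Proof.
rewrite size_flatten /shape -map_comp sumnE big_map big_enum.
by apply: eq_bigr => i _; rewrite /= size_nseq.
Qed.

Lemma mem_row_seq m (b : {ffun 'I_m -> int}) i :
  0 <= b i -> (i \in row_seq b) = (i \in Supp b).
Proof.
move=> b_ge0; rewrite -has_pred1 has_count count_row_seq inE lt0r b_ge0 andbT.
by rewrite absz_gt0.
Qed.

Unset Implicit Arguments.

Theorem mainTheorem3 (m n : nat) (m_gt0 : (0 < m)%N) (n_gt0 : (0 < n)%N)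
    (K : fieldType) (L : 'M[{mpoly K[m * n]}]_(m, n))
    (L_deg : forall i j, multihomog (std_basis i) (L i j)) :
  is_hilbert_series (matrix_subalg L) (minor2_ideal L)
    (* coefficient of y^b; the inner sum over a contributes its term a = b if b
       is in its range, and nothing otherwise *)
    (fun b : {ffun 'I_m -> int} =>
       (\sum_(A : {set 'I_m} | [forall i, 0 <= b i]%R && (Supp b == A))
          bin_pred (phi L A) (abs_deg b))%N).
Proof.
(* A degree with a negative entry has no monomials, and the series no term. *)
move=> b; have [/forallP b_ge0|b_neg] := boolP [forall i, 0 <= b i]; last first.
  rewrite big_pred0 //; exists (fun _ => 0); split=> [[]//|f [_ homf]|c _ []//].
  exists (fun _ => 0); rewrite big_ord0 subr0.
  suff -> : f = 0 by apply: ideal_gen_zero.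
  apply/mpolyP => u; rewrite mcoeff0 (multihomog_coef0 homf) // => deg_u.
  by case/forallP: b_neg => i; rewrite -deg_u ffunE.
rewrite (eq_bigl _ _ (fun A => eq_sym _ A)) big_pred1_eq.
have [p [P [Q [def_p QP kerP]]]] :=
  subspace_as_kernel (\sum_(i in Supp b) linrel (fun j => L i j)).
have mem_s : row_seq b =i Supp b by move=> i; apply: mem_row_seq.
rewrite /phi -def_p -size_row_seq -card_sorted_tuples_bin_pred.
  apply: (quotient_dim_std L_deg QP kerP mem_s) => i.
  by rewrite count_row_seq gez0_abs.
(* In degree 0 the support is empty, hence W = 0 and p = n > 0. *)
rewrite addn_gt0; case: (posnP (size (row_seq b))) => [/size0nil s0|]; last first.
  by rewrite orbT.
rewrite def_p big_pred0 ?dimv0 ?subn0 ?n_gt0 // => i.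
by rewrite -mem_s s0.
Qed.
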